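(* Let $n$ be an integer with $n\ge 5$. If an edge-colored $K_n^{(3)}$ is rainbow $F_5$-free, then it is rainbow $F_4$-free. In particular, it is rainbow cancellative.
   Context: $K_n^{(3)}$ is the complete $3$-uniform hypergraph on $n$ vertices. An edge-coloring of it is a surjection from its edge set onto a set of colors. A sub-hypergraph is rainbow if its edges receive pairwise distinct colors. For a $3$-graph $F$, an edge-colored $3$-graph is rainbow $F$-free if it contains no rainbow copy of $F$. Here $F_4=\{abc,abd,bcd\}$ (on four distinct vertices $a,b,c,d$) and $F_5=\{abc,abd,cde\}$ (on five distinct vertices $a,b,c,d,e$). An edge-colored $K_n^{(3)}$ is rainbow cancellative if there are no three edges $A,B,C$ of pairwise distinct colors with $A\triangle B\subseteq C$, where $\triangle$ is symmetric difference. *)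

(* Defs.v *)
From mathcomp Require Import all_boot.
Set Implicit Arguments.
Unset Strict Implicit.
Unset Printing Implicit Defensive.

Record graph3 (V : finType) := Graph3 {
  edges : {set {set V}};
  edges_card3 : forall e, e \in edges -> #|e| = 3 }.

Lemma complete3_card3 n (e : {set 'I_n}) :
  e \in [set e : {set 'I_n} | #|e| == 3] -> #|e| = 3.
Proof. by rewrite inE => /eqP. Qed.

Definition complete3 (n : nat) : graph3 'I_n := Graph3 (@complete3_card3 n).

Definition triple (n i j k : nat) : {set 'I_n.+1} :=
  [set inord i; inord j; inord k].

Lemma card_triple n i j k :
  [&& i <= n, j <= n & k <= n] -> uniq [:: i; j; k] -> #|triple n i j k| = 3.
Proof.
move=> /and3P[hi hj hk]; rewrite /= !inE negb_or andbT => /andP[/andP[ij ik] jk].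
rewrite /triple -setUA !cardsU1 cards1 !inE -!val_eqE /= !inordK //.
by rewrite negb_or ij ik jk.
Qed.

(* The vertices a, b, c, d (and e) are 0, 1, 2, 3 (and 4). *)
Definition F4_edges : {set {set 'I_4}} :=
  [set triple 3 0 1 2; triple 3 0 1 3; triple 3 1 2 3].

Lemma F4_card3 e : e \in F4_edges -> #|e| = 3.
Proof. by rewrite !inE -orbA => /or3P[] /eqP->; apply: card_triple. Qed.

Definition F4 : graph3 'I_4 := Graph3 F4_card3.

Definition F5_edges : {set {set 'I_5}} :=
  [set triple 4 0 1 2; triple 4 0 1 3; triple 4 2 3 4].

Lemma F5_card3 e : e \in F5_edges -> #|e| = 3.
Proof. by rewrite !inE -orbA => /or3P[] /eqP->; apply: card_triple. Qed.

Definition F5 : graph3 'I_5 := Graph3 F5_card3.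

Definition edge (V : finType) (H : graph3 V) : Type :=
  {e : {set V} | e \in edges H}.

Record edge_coloring (V : finType) (H : graph3 V) (K : Type) := EdgeColoring {
  color :> edge H -> K;
  color_surj : forall k : K, exists e : edge H, color e = k }.

Definition rainbow (V : finType) (H : graph3 V) (K : Type)
    (col : edge_coloring H K) (S : {set {set V}}) : Prop :=
  forall e1 e2 : edge H, val e1 \in S -> val e2 \in S ->
    col e1 = col e2 -> e1 = e2.

Definition is_copy (W V : finType) (F : graph3 W) (H : graph3 V)
    (S : {set {set V}}) : Prop :=
  exists2 f : W -> V, injective f &
    S = [set f @: (e : {set W}) | e in edges F] /\ S \subset edges H.

Definition rainbow_free (W V : finType) (F : graph3 W) (H : graph3 V)
    (K : Type) (col : edge_coloring H K) : Prop :=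
  ~ exists2 S : {set {set V}}, is_copy F H S & rainbow col S.

Definition symdiff (T : finType) (A B : {set T}) : {set T} :=
  (A :\: B) :|: (B :\: A).

Definition rainbow_cancellative (V : finType) (H : graph3 V) (K : Type)
    (col : edge_coloring H K) : Prop :=
  ~ exists A B C : edge H,
      [/\ col A <> col B, col A <> col C, col B <> col C
        & symdiff (val A) (val B) \subset val C].

(* Main.v *)
Require Import Defs.
From mathcomp Require Import all_boot zify.
From Stdlib Require Import Classical.
Set Implicit Arguments.
Unset Strict Implicit.
Unset Printing Implicit Defensive.

(** The heart of the matter is a claim about five vertices.  Suppose that the
    three edges through [b] inside [{b, x, y, z}] have distinct colours; these
    edges form a copy of F4, and every copy of F4 has this shape.  Write [cx],
    [cy], [cz] for the colours of [byz], [bxz], [bxy], so that the index is the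
    vertex left out.  For a fifth vertex [e] let [fx], [fy], [fz] be the colours
    of [yze], [xze], [xye].  Suitable copies of F5 on these five vertices force
    in turn:
    - [fx] is [cy] or [cz] ([star_opposite_color]);
    - [bxe] has the same colour [fx] as [yze] ([star_spoke_color]);
    - the colour [h] of [xyz] is [cx] or [fx] ([star_base_color]);
    and the same holds with [x], [y], [z] permuted.  Hence [h] is one of [cx],
    [cy], [cz], say [cx].  As [cx] differs from [cy] and [cz], the third
    point for [y] and [z] gives [fy = fz = cx], and then two more copies of F5
    force [fx = cy] and [fx = cz], which is absurd
    ([star_base_color_neq]).  So there is no rainbow star ([no_rainbow_star]).

    Since [n >= 5], each copy of F4 leaves a fifth vertex available, so there is
    no rainbow F4.  For cancellativity, two distinct triples [A] and [B] whose
    symmetric difference lies in a triple [C] share exactly two vertices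
    ([symdiff_sub_triple]); the third vertex of [C] is either one of these two,
    which makes the three edges a copy of F4, or new, which makes them a copy
    of F5. *)

(** * Colourings of triples without rainbow F5 *)

Notation tri x y z := [set x; y; z].

Lemma triC (T : finType) (x y z : T) : tri x y z = tri y x z.
Proof. by rewrite (setUC [set x]). Qed.

Lemma triAC (T : finType) (x y z : T) : tri x y z = tri x z y.
Proof. exact: setUAC. Qed.

Lemma tri_rot (T : finType) (x y z : T) : tri x y z = tri y z x.
Proof. by rewrite triC triAC. Qed.

Lemma uniq_eq_count (T : eqType) (s t : seq T) :
  (forall p, count p s = count p t) -> uniq s -> uniq t.
Proof. by move=> /permP/perm_uniq->. Qed.

(** Colours live on all sets rather than on the edge subtype, so that triples
    can be rewritten freely. *)
Definition no_rainbow_F5 (T : finType) (X : Type) (c : {set T} -> X) : Prop :=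
  forall x y z w v : T, uniq [:: x; y; z; w; v] ->
    [\/ c (tri x y z) = c (tri x y w), c (tri x y z) = c (tri z w v)
      | c (tri x y w) = c (tri z w v)].

(** Singling out the vertex [b] common to the three edges of F4 makes the
    symmetry of F4 in its other three vertices visible. *)
Definition rainbow_star (T : finType) (X : Type) (c : {set T} -> X)
    (b x y z : T) : Prop :=
  [/\ c (tri b x y) <> c (tri b x z), c (tri b x y) <> c (tri b y z)
    & c (tri b x z) <> c (tri b y z)].

(** Counting turns a rearrangement of a list of variables into commutativity of
    addition. *)
Ltac permute_uniq :=
  match goal with U : is_true (uniq _) |- _ =>
    by apply: uniq_eq_count U => p /=; lia end.

Lemma rainbow_star_rot (T : finType) (X : Type) (c : {set T} -> X) b x y z :
  rainbow_star c b x y z -> rainbow_star c b y z x.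
Proof.
case=> n1 n2 n3; split; rewrite ?(triAC b y x) ?(triAC b z x) => E.
- exact: n2.
- exact: n3.
- exact: n1.
Qed.

(** The edges [bxy], [bxz] and [yze] form a copy of F5. *)
Lemma star_opposite_color (T : finType) (X : Type) (c : {set T} -> X)
    b x y z e :
  no_rainbow_F5 c -> uniq [:: b; x; y; z; e] -> rainbow_star c b x y z ->
  c (tri y z e) = c (tri b x y) \/ c (tri y z e) = c (tri b x z).
Proof. by move=> F5c U [n1 _ _]; case: (F5c b x y z e U) => E; auto. Qed.

(** One of the pairs [bxy], [yze] and [bxz], [yze] has two colours, which
    confines the colour of [bxe] to those of [bxy] and [bxz]; comparison with
    [byz] then leaves only the colour of [yze]. *)
Lemma star_spoke_color (T : finType) (X : Type) (c : {set T} -> X) b x y z e :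
  no_rainbow_F5 c -> uniq [:: b; x; y; z; e] -> rainbow_star c b x y z ->
  c (tri b x e) = c (tri y z e).
Proof.
move=> F5c U S; have fx := star_opposite_color F5c U S.
have H1 := F5c b x y e z; have H2 := F5c b x z e y; have H3 := F5c y z b e x.
move: H1 H2 H3.
rewrite (triAC y e z) (triAC z e y) (triC z y e) -(tri_rot b y z) (triAC b e x).
move=> /(_ ltac:(permute_uniq)) H1 /(_ ltac:(permute_uniq)) H2.
move=> /(_ ltac:(permute_uniq)) H3.
by case: S => n1 n2 n3; case: fx => fx; case: H1 => H1; case: H2 => H2;
  case: H3 => H3; congruence.
Qed.

(** The edges [yzx], [yzb] and [xbe] form a copy of F5, and [xbe] has the
    colour of [yze]. *)
Lemma star_base_color (T : finType) (X : Type) (c : {set T} -> X) b x y z e :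
  no_rainbow_F5 c -> uniq [:: b; x; y; z; e] -> rainbow_star c b x y z ->
  c (tri x y z) = c (tri b y z) \/ c (tri x y z) = c (tri y z e).
Proof.
move=> F5c U S; have fx := star_opposite_color F5c U S.
have gx := star_spoke_color F5c U S.
have := F5c y z x b e.
rewrite -(tri_rot x y z) -(tri_rot b y z) (triC x b e) gx.
move=> /(_ ltac:(permute_uniq)) [E|E|E]; [by left | by right |].
by case: S => n1 n2 n3; case: fx => fx; congruence.
Qed.

(** If [xyz] had the colour of [byz], then so would [xye] and [xze]; the copies
    [{yex, yez, xzb}] and [{zex, zey, xyb}] of F5 would then require of [yze]
    the colours of [bxz] and of [bxy] at once. *)
Lemma star_base_color_neq (T : finType) (X : Type) (c : {set T} -> X)
    b x y z e :
  no_rainbow_F5 c -> uniq [:: b; x; y; z; e] -> rainbow_star c b x y z ->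
  c (tri x y z) <> c (tri b y z).
Proof.
move=> F5c U S h.
have S1 := rainbow_star_rot S; have S2 := rainbow_star_rot S1.
have U1 : uniq [:: b; y; z; x; e] by permute_uniq.
have U2 : uniq [:: b; z; x; y; e] by permute_uniq.
have fx := star_opposite_color F5c U S.
have hy := star_base_color F5c U1 S1.
have hz := star_base_color F5c U2 S2.
have H1 := F5c y e x z b; have H2 := F5c z e x y b.
move: hy hz H1 H2.
rewrite -(tri_rot x y z) (tri_rot z x y) (triAC b z x).
rewrite -(tri_rot x y e) (triAC y e z) -(tri_rot b x z).
rewrite (triC z x e) -(tri_rot x z e).
rewrite (triAC z e y) (triC z y e) -(tri_rot b x y).
move=> hy hz /(_ ltac:(permute_uniq)) H1 /(_ ltac:(permute_uniq)) H2.
by case: S => n1 n2 n3; case: fx => fx; case: hy => hy; case: hz => hz;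
  case: H1 => H1; case: H2 => H2; congruence.
Qed.

Lemma no_rainbow_star (T : finType) (X : Type) (c : {set T} -> X) b x y z e :
  no_rainbow_F5 c -> uniq [:: b; x; y; z; e] -> ~ rainbow_star c b x y z.
Proof.
move=> F5c U S.
have S1 := rainbow_star_rot S; have S2 := rainbow_star_rot S1.
have U1 : uniq [:: b; y; z; x; e] by permute_uniq.
have U2 : uniq [:: b; z; x; y; e] by permute_uniq.
have nx := star_base_color_neq F5c U S.
have := star_base_color_neq F5c U1 S1; rewrite -(tri_rot x y z) (triAC b z x).
have := star_base_color_neq F5c U2 S2; rewrite (tri_rot z x y).
have fx := star_opposite_color F5c U S => nz ny.
by case: (star_base_color F5c U S) => h; case: fx => fx; congruence.
Qed.

(** * Rainbow copies in an edge-coloured complete 3-graph *)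

Definition set_color (V : finType) (H : graph3 V) (K : Type)
    (col : edge_coloring H K) (A : {set V}) : option K :=
  omap col (insub A : option (edge H)).

Lemma set_color_val (V : finType) (H : graph3 V) (K : Type)
    (col : edge_coloring H K) (e : edge H) :
  set_color col (val e) = Some (col e).
Proof. by rewrite /set_color valK. Qed.

Lemma rainbowP (V : finType) (H : graph3 V) (K : Type)
    (col : edge_coloring H K) (S : {set {set V}}) :
  S \subset edges H ->
  rainbow col S <-> {in S &, injective (set_color col)}.
Proof.
move=> /subsetP sSH; split=> [rS A B AS BS | iS e1 e2 e1S e2S Ecol]; last first.
  by apply/val_inj/iS => //; rewrite !set_color_val Ecol.
rewrite -(SubK (edge H) (sSH A AS)) -(SubK (edge H) (sSH B BS)) !set_color_val.
by case=> /rS -> //; rewrite SubK.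
Qed.

Lemma imset_triple (V : finType) n (f : 'I_n.+1 -> V) i j k :
  f @: triple n i j k = tri (f (inord i)) (f (inord j)) (f (inord k)).
Proof. by rewrite /triple !imsetU !imset_set1. Qed.

Lemma imset_set3 (S T : finType) (f : S -> T) x y z :
  f @: tri x y z = tri (f x) (f y) (f z).
Proof. by rewrite !imsetU !imset_set1. Qed.

Lemma inj_in3 (T : finType) (X : Type) (c : T -> X) x y z :
  c x <> c y -> c x <> c z -> c y <> c z -> {in tri x y z &, injective c}.
Proof.
move=> n1 n2 n3 u v; rewrite !inE -!orbA.
by move=> /or3P[]/eqP-> /or3P[]/eqP-> E; rewrite ?E //; congruence.
Qed.

Lemma card_tri (T : finType) (x y z : T) : uniq [:: x; y; z] -> #|tri x y z| = 3.
Proof.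
by rewrite /= !inE andbT -setUA !cardsU1 cards1 !inE => /andP[-> ->].
Qed.

Lemma no_rainbow_F5_set_color n (K : Type)
    (col : edge_coloring (complete3 n) K) :
  rainbow_free F5 col -> no_rainbow_F5 (set_color col).
Proof.
move=> F5free x y z w v U; apply: NNPP => nE; apply: F5free.
pose f (i : 'I_5) := nth x [:: x; y; z; w; v] i.
have f_inj : injective f.
  by move=> i j /eqP; rewrite nth_uniq // => /eqP/val_inj.
have fE i : i < 5 -> f (inord i) = nth x [:: x; y; z; w; v] i.
  by move=> lti; rewrite /f inordK.
have imF : [set f @: (e : {set _}) | e in edges F5]
    = [set tri x y z; tri x y w; tri z w v].
  by rewrite imset_set3 !imset_triple !fE.
have sH : [set tri x y z; tri x y w; tri z w v] \subset edges (complete3 n).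
  apply/subsetP=> A; rewrite !inE -orbA.
  move: U; rewrite /= !inE !negb_or.
  move=> /and5P[/and4P[? ? ? ?] /and3P[? ? ?] /andP[? ?] ? _].
  by move=> /or3P[]/eqP->; apply/eqP/card_tri; rewrite /= !inE !negb_or;
    do ?[apply/andP; split].
exists [set tri x y z; tri x y w; tri z w v]; first by exists f; rewrite ?imF.
by apply/(rainbowP _ sH)/inj_in3 => E; apply: nE;
  [constructor 1 | constructor 2 | constructor 3].
Qed.

Lemma exists_notin n (s : seq 'I_n) :
  size s < n -> exists e, e \notin s.
Proof.
move=> lt_s; apply/existsP; rewrite -negb_forall; apply/negP=> /forallP alls.
have : #|'I_n| <= size s.
  by rewrite cardT; apply: uniq_leq_size (enum_uniq _) _ => i _.
by rewrite card_ord leqNgt lt_s.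
Qed.

Lemma tri_neq (T : finType) (x y z w : T) :
  uniq [:: x; y; z; w] -> tri x y z <> tri x y w.
Proof.
rewrite /= !inE !negb_or => /and4P[/and3P[_ xz _] /andP[yz _] zw _] /setP/(_ z).
rewrite !inE eqxx orbT (eq_sym z x) (eq_sym z y).
by rewrite (negPf xz) (negPf yz) (negPf zw).
Qed.

(** Equality of cardinals makes [A :\: B] and [B :\: A] equally large, and
    together they have at most three elements, so each has exactly one. *)
Lemma symdiff_sub_triple (T : finType) (A B C : {set T}) :
  #|A| = 3 -> #|B| = 3 -> #|C| = 3 -> A <> B -> symdiff A B \subset C ->
  exists x y z w v, [/\ A = tri x y z, B = tri x y w, C = tri z w v,
    uniq [:: x; y; z; w] & uniq [:: z; w; v]].
Proof.
move=> cA cB cC nAB sC.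
have dAB : (A :\: B) :&: (B :\: A) = set0.
  by apply/setP=> u; rewrite !inE; case: (u \in A); case: (u \in B).
have := subset_leq_card sC; rewrite /symdiff cardsU dAB cards0 subn0 cC.
have := cardsID B A; have := cardsID A B; rewrite (setIC B) cA cB => cBD cAD le3.
have nz : #|A :\: B| != 0.
  apply/negP; rewrite cards_eq0 setD_eq0 => sAB; apply: nAB.
  by apply/eqP; rewrite eqEcard sAB cA cB.
have /cards1P[z Ez] : #|A :\: B| == 1 by lia.
have /cards1P[w Ew] : #|B :\: A| == 1 by lia.
have /cards2P[x [y [xy Exy]]] : #|A :&: B| == 2 by lia.
have EA : A = tri x y z by rewrite -(setID A B) Exy Ez.
have EB : B = tri x y w by rewrite -(setID B A) setIC Exy Ew.
have : z \in A :\: B by rewrite Ez set11.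
have : w \in B :\: A by rewrite Ew set11.
rewrite {1}EA {2}EB !inE !negb_or => /andP[/andP[/andP[wx wy] wz] _].
move=> /andP[/andP[/andP[zx zy] zw] _].
have sC2 : [set z; w] \subset C by rewrite -Ez -Ew.
have /cards1P[v Ev] : #|C :\: [set z; w]| == 1.
  by rewrite cardsDS // cC cards2 zw.
have : v \in C :\: [set z; w] by rewrite Ev set11.
rewrite !inE negb_or => /andP[/andP[vz vw] _].
exists x, y, z, w, v; split=> //.
- by rewrite -(setID C [set z; w]) Ev (setIidPr sC2).
- by rewrite /= !inE !negb_or xy zw !(eq_sym x) !(eq_sym y) zx wx zy wy.
- by rewrite /= !inE !negb_or zw !(eq_sym _ v) vz vw.
Qed.

Theorem theorem1p3 (n : nat) (hn : 5 <= n) (K : Type)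
    (col : edge_coloring (complete3 n) K) :
  rainbow_free F5 col -> rainbow_free F4 col /\ rainbow_cancellative col.
Proof.
move=> /no_rainbow_F5_set_color F5c.
have no_star b x y z : uniq [:: b; x; y; z] ->
    ~ rainbow_star (set_color col) b x y z.
  move=> U; have [e eN] := @exists_notin n [:: b; x; y; z] hn.
  apply: (@no_rainbow_star _ _ _ b x y z e F5c).
  by rewrite -[[:: b; x; y; z; e]]/(rcons [:: b; x; y; z] e) rcons_uniq eN.
split.
(* The vertex of F4 that lies in all three edges is 1. *)
- case=> S [f f_inj [-> sH]] /(rainbowP _ sH) iS.
  pose g i := f (inord i).
  have g_eq i j : i < 4 -> j < 4 -> (g i == g j) = (i == j).
    by move=> lti ltj; rewrite (inj_eq f_inj) -val_eqE /= !inordK.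
  move: iS; rewrite imset_set3 !imset_triple -!/(g _) !(triC (g 0)) => iS.
  have U : uniq [:: g 1; g 0; g 2; g 3] by rewrite /= !inE !g_eq.
  apply: (no_star _ _ _ _ U).
  have n1 := tri_neq U.
  have n2 : tri (g 1) (g 2) (g 0) <> tri (g 1) (g 2) (g 3).
    by apply: tri_neq; permute_uniq.
  have n3 : tri (g 1) (g 3) (g 0) <> tri (g 1) (g 3) (g 2).
    by apply: tri_neq; permute_uniq.
  split=> /iS E.
  + by apply/n1/E; rewrite !inE eqxx ?orbT.
  + by apply: n2; rewrite triAC; apply: E; rewrite !inE eqxx ?orbT.
  + apply: n3; rewrite triAC (triAC _ (g 3)).
    by apply: E; rewrite !inE eqxx ?orbT.
- case=> A [B [C [nAB nAC nBC]]] sC.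
  have c3 (E : edge (complete3 n)) : #|val E| = 3 by apply: edges_card3 (valP E).
  have nvAB : val A <> val B by move=> /val_inj E; apply: nAB; rewrite E.
  have [x [y [z [w [v [EA EB EC U Uv]]]]]] :=
    symdiff_sub_triple (c3 A) (c3 B) (c3 C) nvAB sC.
  have kAB : set_color col (tri x y z) <> set_color col (tri x y w).
    by rewrite -EA -EB !set_color_val => -[].
  have kAC : set_color col (tri x y z) <> set_color col (tri z w v).
    by rewrite -EA -EC !set_color_val => -[].
  have kBC : set_color col (tri x y w) <> set_color col (tri z w v).
    by rewrite -EB -EC !set_color_val => -[].
  have [vx|vx] := eqVneq v x.
    apply: (no_star x y z w U).
    by subst v; rewrite /rainbow_star (tri_rot x z w).
  have [vy|vy] := eqVneq v y.
    apply: (no_star y x z w); first by permute_uniq.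
    by subst v; rewrite /rainbow_star !(triC y x) (tri_rot y z w).
  have U5 : uniq [:: x; y; z; w; v].
    move: U Uv; rewrite /= !inE !negb_or (eq_sym x v) (eq_sym y v) vx vy.
    by do !case: (_ == _).
  by case: (F5c x y z w v U5).
Qed.
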